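(* Let $E$ be a Polish space, let $c:E\times E\to[0,\infty)$ be a lower semicontinuous quasi-pseudo-metric, and let $g:E\to\mathbb{R}$ be Borel measurable. Assume that $\gamma\in[0,1]$, that $X\le_{\gamma,g}Y$ for $X,Y\in\mathcal{L}_{c,g}(E)$ with $\mathbb{E}[g(X)]<\mathbb{E}[g(Y)]$, and that there exists a (Borel measurable) metric $d$ on $E$ such that $c\le d$ and $$|\mathbb{E}[g(\hat X)]-\mathbb{E}[g(\hat Y)]|\le \mathrm{OT}_d(\hat X,\hat Y)\quad\text{for all }\hat X,\hat Y\in\mathcal{L}_g(E).$$ If $\mathrm{OT}_d(Y,\tilde Y)\le\epsilon\le\mathbb{E}[g(Y)]-\mathbb{E}[g(X)]$ for some $\tilde Y\in\mathcal{L}_{c,g}(E)$, then $$\gamma^\ast(X,\tilde Y;g)\le\tilde\gamma:=\gamma+\frac{(1-\gamma)\epsilon}{\mathbb{E}[g(Y)]-\mathbb{E}[g(X)]}.$$ Analogously, if $\mathrm{OT}_d(X,\tilde X)\le\epsilon\le\mathbb{E}[g(Y)]-\mathbb{E}[g(X)]$ for some $\tilde X\in\mathcal{L}_{c,g}(E)$, then $\gamma^\ast(\tilde X,Y;g)\le\tilde\gamma$ for the same $\tilde\gamma$.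
   Context: A quasi-pseudo-metric on $E$ is a map $c:E\times E\to[0,\infty)$ with $c(x,x)=0$ for all $x\in E$ and $c(x,z)\le c(x,y)+c(y,z)$ for all $x,y,z\in E$. Lower semicontinuity of $c$ is with respect to the product topology on $E\times E$. For a Borel measurable $c:E\times E\to[0,\infty)$ and $E$-valued random variables $X,Y$, $\mathrm{OT}_c(X,Y):=\inf \mathbb{E}[c(\tilde X,\tilde Y)]\in[0,\infty]$, where the infimum is over all couplings, i.e. all pairs $(\tilde X,\tilde Y)$ of $E$-valued random variables with $\tilde X\overset{d}{=}X$ and $\tilde Y\overset{d}{=}Y$ (equality in law). $\mathrm{OT}_d$ is defined in the same way with cost $d$. $\mathcal{L}_g(E)$ is the set of $E$-valued random variables $X$ with $\mathbb{E}[|g(X)|]<\infty$. $\mathcal{L}_{c,g}(E)$ is the set of $E$-valued random variables $X$ for which there exists $x_0\in E$ with $\mathbb{E}[c(X,x_0)+c(x_0,X)+|g(X)|]<\infty$. For $X,Y\in\mathcal{L}_{c,g}(E)$ with $\mathbb{E}[g(X)]\le\mathbb{E}[g(Y)]$ define $$\gamma^\ast(X,Y;g):=\frac{\mathrm{OT}_c(X,Y)}{\mathbb{E}[g(Y)]-\mathbb{E}[g(X)]+\mathrm{OT}_c(X,Y)},\qquad 0/0:=0$$ (the assertions $\gamma^\ast(X,\tilde Y;g)\le\tilde\gamma$ and $\gamma^\ast(\tilde X,Y;g)\le\tilde\gamma$ include that the respective quantity is defined). For $\gamma\in[0,1]$ and $X,Y\in\mathcal{L}_{c,g}(E)$, write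 $X\le_{\gamma,g}Y$ if $\mathbb{E}[g(X)]\le\mathbb{E}[g(Y)]$ and $\gamma^\ast(X,Y;g)\le\gamma$. *)

(* Defs.v *)
From HB Require Import structures.
From mathcomp Require Import all_boot all_order all_algebra.
From mathcomp Require Import all_classical all_reals all_analysis.

Set Implicit Arguments.
Unset Strict Implicit.
Unset Printing Implicit Defensive.

Import Order.TTheory GRing.Theory Num.Theory.
Import numFieldNormedType.Exports.

Local Open Scope classical_set_scope.
Local Open Scope ring_scope.

Definition is_metric (R : realType) (T : Type) (m : T -> T -> R) : Prop :=
  [/\ forall x y, 0 <= m x y,
      forall x y, m x y = 0 <-> x = y,
      forall x y, m x y = m y x
    & forall x y z, m x z <= m x y + m y z].

Definition quasi_pseudo_metric (R : realType) (T : Type) (c : T -> T -> R) :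
  Prop :=
  [/\ forall x y, 0 <= c x y,
      forall x, c x x = 0
    & forall x y z, c x z <= c x y + c y z].

Definition metrizes (R : realType) (T : topologicalType) (m : T -> T -> R) :
  Prop :=
  forall (x : T) (A : set T),
    nbhs x A <-> exists2 r : R, 0 < r & [set y | m x y < r] `<=` A.

Definition complete_metric (R : realType) (T : topologicalType)
    (m : T -> T -> R) : Prop :=
  forall u : nat -> T,
    (forall e : R, 0 < e ->
      exists N : nat, forall i j, (N <= i)%N -> (N <= j)%N -> m (u i) (u j) < e) ->
    exists l : T, u @ \oo --> l.

Definition polish (R : realType) (T : topologicalType) : Prop :=
  (exists2 D : set T, countable D & dense D) /\
  (exists m : T -> T -> R, [/\ is_metric m, metrizes m & complete_metric m]).

(* [T] with its Borel sigma-algebra.  Measurable types are pointed in the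
   library, hence so is [T]; only the empty space, which carries no random
   variable, is left out. *)
Notation borel T := (g_sigma_algebraType (@open T)).

(* Each random variable carries its own probability space, so that statements
   about "all random variables" range over all probability spaces. *)
Record rvar (R : realType) (E : ptopologicalType) := RVar {
  rv_disp : measure_display;
  rv_space : measurableType rv_disp;
  rv_prob : probability rv_space R;
  rv_fun :> {mfun rv_space >-> borel E} }.

Arguments RVar {R E rv_disp rv_space} rv_prob rv_fun.

Section optimal_transport.
Context {R : realType} {E : ptopologicalType}.
Implicit Types (c : E -> E -> R) (g : E -> R) (X Y : rvar R E).

Definition same_law X Y : Prop :=
  forall A : set (borel E), measurable A ->
    distribution (rv_prob X) (rv_fun X) A = distribution (rv_prob Y) (rv_fun Y) A.

Definition OT c X Y : \bar R :=
  ereal_inf [set z | exists (d : measure_display) (Omega : measurableType d)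
      (P : probability Omega R) (X' Y' : {mfun Omega >-> borel E}),
    [/\ same_law (RVar P X') X, same_law (RVar P Y') Y
      & z = ('E_P[fun w => c (X' w) (Y' w)])%E]].

Definition in_Lg g X : Prop :=
  ('E_(rv_prob X)[fun w => (`|g (X w)|)%R] < +oo)%E.

Definition in_Lcg c g X : Prop :=
  exists x0 : E,
    ('E_(rv_prob X)[fun w => (c (X w) x0 + c x0 (X w) + `|g (X w)|)%R] < +oo)%E.

(* Meaningful for [X] in L_g, where the expectation is finite. *)
Definition mean g X : R := fine 'E_(rv_prob X)[fun w => g (X w)]%E.

(* Meaningful for [X, Y] in L_{c,g} with [mean g X <= mean g Y].  There [OT c X Y]
   is finite: in the independent coupling, c(X,Y) is at most
   c(X,x0) + c(x0,y0) + c(y0,Y).  The convention 0/0 = 0 is that of division in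
   a MathComp field. *)
Definition gamma_star c g X Y : R :=
  fine (OT c X Y) / (mean g Y - mean g X + fine (OT c X Y)).

Definition gamma_le c g (gamma : R) X Y : Prop :=
  mean g X <= mean g Y /\ gamma_star c g X Y <= gamma.

End optimal_transport.

(* Main.v *)
(** The heart of the matter is the triangle inequality
    OT_c(X, Z) <= OT_c(X, Y) + OT_c(Y, Z); then OT_c <= OT_d, the assumption on
    the means and an elementary computation with ratios give the bound on
    gamma^*.  As c is only lower semicontinuous, couplings of (X, Y) and (Y, Z)
    must be glued exactly.  Coding the Polish space by real numbers reduces
    this to a real third variable, whose conditional distribution function
    given Y is a family of Radon-Nikodym derivatives, monotone off a null set.
    The conditional quantile function, applied to Y and to an independent
    uniform variable, then reproduces the joint law of (Y, Z).  Gluing with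
    constant random variables also shows that OT_c is finite on L_{c,g}. *)

Require Import Defs.
From HB Require Import structures.
From mathcomp Require Import all_boot all_order all_algebra.
From mathcomp Require Import all_classical all_reals all_analysis.
From mathcomp Require Import measurable_realfun.
From mathcomp Require Import ring lra.

Set Implicit Arguments.
Unset Strict Implicit.
Unset Printing Implicit Defensive.

Import Order.TTheory GRing.Theory Num.Theory.
Import numFieldNormedType.Exports.

Local Open Scope classical_set_scope.
Local Open Scope ring_scope.

(** * Real codes for the points of a Polish space *)

Section ternary_coding.
Context {R : realType}.
Implicit Types (b : nat -> bool) (t : R).

(** Partial sum of the first n digits of a ternary expansion, in Horner form. Only the digits 0 and
    2 occur, as in the Cantor set, so that every digit can be read back from the sum. *)
Fixpoint ternary_trunc (n : nat) b : R :=
  if n is n'.+1 then ((if b 0%N then 2 else 0) + ternary_trunc n' (b \o S)) / 3 else 0.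

Lemma ternary_trunc_itv n b : 0 <= ternary_trunc n b <= 1.
Proof.
elim: n b => [|n IHn] b /=; first by rewrite lexx ler01.
by have /andP[] := IHn (b \o S); case: (b 0%N) => /=; lra.
Qed.

Lemma ternary_trunc_nd b : nondecreasing_seq (ternary_trunc ^~ b).
Proof.
apply/nondecreasing_seqP => n; elim: n b => [|n IHn] b.
  by have /andP[] := ternary_trunc_itv 1 b.
by rewrite [leLHS]/= [leRHS]/= ler_pM2r ?invr_gt0// lerD2l; exact: IHn.
Qed.

Definition ternary b : R := limn (ternary_trunc ^~ b).

Lemma ternary_cvg b : ternary_trunc ^~ b @ \oo --> ternary b.
Proof.
apply: nondecreasing_is_cvgn; first exact: ternary_trunc_nd.
by exists 1 => _ [n _ <-]; have /andP[] := ternary_trunc_itv n b.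
Qed.

Lemma ternary_itv b : 0 <= ternary b <= 1.
Proof.
have cb := cvgP _ (@ternary_cvg b).
by apply/andP; split; [apply: limr_ge => //|apply: limr_le => //];
  apply: nearW => n; have /andP[] := ternary_trunc_itv n b.
Qed.

Lemma ternary_rec b : ternary b = ((if b 0%N then 2 else 0) + ternary (b \o S)) / 3.
Proof.
apply/cvg_lim => //; rewrite -cvg_shiftS /=.
by apply: cvgMl; apply: cvgD; [exact: cvg_cst|exact: ternary_cvg].
Qed.

(** The n-fold shift of the ternary expansion. The test against 2/3 finds the leading digit, because
    a value of [ternary] is at most 1/3 if that digit is 0 and at least 2/3 if it is 2. *)
Fixpoint ternary_rest (n : nat) t : R :=
  if n is n'.+1 then
    3 * ternary_rest n' t - (if 2 / 3 <= ternary_rest n' t then 2 else 0)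
  else t.

Lemma ternary_rest_ternary n b :
  ternary_rest n (ternary b) = ternary (fun k => b (n + k)%N).
Proof.
elim: n => [//|n IHn] /=; rewrite IHn ternary_rec addn0.
have -> : (fun k => b (n + k)%N) \o S = fun k => b (n.+1 + k)%N.
  by apply/funext => k /=; rewrite addnS.
have /andP[] := ternary_itv (fun k => b (n.+1 + k)%N).
by case: (b n) => /= h0 h1; case: leP => /=; lra.
Qed.

Lemma ternary_rest_digit n b :
  (2 / 3 <= ternary_rest n (ternary b)) = b n.
Proof.
rewrite ternary_rest_ternary ternary_rec addn0.
have /andP[] := ternary_itv ((fun k => b (n + k)%N) \o S).
by case: (b n) => /= h0 h1; case: leP => /=; lra.
Qed.

Lemma measurable_ternary_rest n :
  measurable_fun [set: R] (ternary_rest n : R -> R).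
Proof.
elim: n => [|n IHn] /=; first exact: measurable_id.
apply: measurable_funB; first exact: measurable_funM.
by apply: measurable_fun_ifT => //; exact: measurable_fun_ler.
Qed.

Lemma measurable_ternary d (T : measurableType d) (B : nat -> T -> bool) :
  (forall n, measurable_fun [set: T] (B n)) ->
  measurable_fun [set: T] (fun x => ternary (B ^~ x) : R).
Proof.
move=> mB; apply: (@measurable_fun_cvg _ _ _ _
  (fun n x => ternary_trunc n (B ^~ x))); last by move=> x _; exact: ternary_cvg.
move=> n; elim: n B mB => [|n IHn] B mB /=; first exact: measurable_cst.
apply: measurable_funM => //; apply: measurable_funD.
  exact: measurable_fun_ifT.
by apply: (IHn (fun k => B k.+1)) => k; exact: mB.
Qed.

End ternary_coding.

(* The n-th ternary digit of [phi x] is 2 if [B n x] holds, and 0 otherwise. *)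
Lemma real_coding (R : realType) d (T : measurableType d) (B : nat -> set T) :
  (forall n, measurable (B n)) ->
  exists (phi : T -> R) (C : nat -> set R),
    [/\ measurable_fun [set: T] phi, forall x, 0 <= phi x <= 1,
        forall n, measurable (C n) & forall n x, C n (phi x) <-> B n x].
Proof.
move=> mB; pose b n x := `[< B n x >].
exists (fun x => ternary (b ^~ x)).
exists (fun n => [set t | 2 / 3 <= ternary_rest n t]); split.
- apply: measurable_ternary => n; apply: (measurable_fun_bool true).
  rewrite setTI [X in measurable X](_ : _ = B n)//.
  by apply/seteqP; split => x; rewrite /b /= => /asboolP.
- by move=> x; exact: ternary_itv.
- move=> n; rewrite -[X in measurable X]setTI.
  rewrite (_ : [set t | _] = ternary_rest n @^-1` `[2 / 3, +oo[%classic).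
    by apply: measurable_ternary_rest => //; exact: measurable_itv.
  by apply/seteqP; split => t /=; rewrite in_itv /= andbT.
- by move=> n x /=; rewrite ternary_rest_digit; split => /asboolP.
Qed.

Lemma bigcup_countType_measurable d (T : measurableType d) (I : countType)
    (P : set I) (F : I -> set T) :
  (forall i, P i -> measurable (F i)) -> measurable (\bigcup_(i in P) F i).
Proof.
move=> mF; rewrite bigcup_mkcond; apply: countable_bigcupT_measurable => // i.
by case: ifPn => // /set_mem; exact: mF.
Qed.

(** * Encoding and decoding by countably many balls *)

Section polish_coding.
Context {R : realType} {E : ptopologicalType}.
Variable m : E -> E -> R.
Hypotheses (m_metric : is_metric m) (mE : metrizes m).

Lemma metric_ball_open x r : open [set y | m x y < r].
Proof.
have [_ _ _ mtri] := m_metric; rewrite openE => y /= xy.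
apply/(mE y); exists (r - m x y); first by rewrite subr_gt0.
by move=> w /= yw; have := mtri x y w; lra.
Qed.

Variable z : nat -> E.
Hypothesis z_dense : forall x (e : R), 0 < e -> exists k, m (z k) x < e.

Variable rad : nat -> R.
Hypotheses (rad_gt0 : forall n, 0 < rad n)
  (rad_small : forall e, 0 < e -> exists N, forall n, (N <= n)%N -> rad n < e).

(** If the ball of radius r about x lies in O, then so does any ball of radius below r/2 that
    contains x; density of the centers supplies one. *)
Lemma open_bigcup_balls (O : set E) : open O ->
  O = \bigcup_(i in [set i : nat * nat |
                      [set y | m (z i.1) y < rad i.2] `<=` O])
        [set y | m (z i.1) y < rad i.2].
Proof.
have [m0 mxx msym mtri] := m_metric.
rewrite openE => oO; apply/seteqP; split => [x Ox|x [i /= iO]]; last exact: iO.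
have /(mE x)[r r0 rO] := oO _ Ox.
have [|n /(_ n (leqnn n)) nr] := rad_small (e := r / 2); first lra.
have [k kx] := z_dense x (rad_gt0 n).
exists (k, n) => //= y /= ky; apply: rO => /=.
by have := mtri x (z k) y; rewrite (msym x (z k)); lra.
Qed.

Lemma measurable_fun_balls d (T : measurableType d) (f : T -> borel E) :
  (forall k r, measurable [set t | m (z k) (f t) < r]) ->
  measurable_fun [set: T] f.
Proof.
move=> mf; apply: (measurability (@open E : set (set (borel E)))) => //.
move=> _ [U oU <-]; rewrite setTI (open_bigcup_balls oU) preimage_bigcup.
by apply: bigcup_countType_measurable => i _; exact: mf.
Qed.

Hypothesis m_complete : complete_metric m.

(* [C n k] is meant to be the set of codes of the points at distance less than
   [rad n] from [z k]; a real number is decoded when the balls it selects are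
   pairwise compatible, and then to the limit of their centers. *)
Lemma polish_decoding (C : nat -> nat -> set R) :
  (forall n k, measurable (C n k)) ->
  exists psi : R -> borel E, measurable_fun [set: R] psi /\
    forall t x, (forall n k, C n k t <-> m (z k) x < rad n) -> psi t = x.
Proof.
have [m0 mxx msym mtri] := m_metric; move=> mC.
pose bad := \bigcup_(i in [set i : (nat * nat) * (nat * nat) |
    rad i.1.1 + rad i.2.1 < m (z i.1.2) (z i.2.2)])
  (C i.1.1 i.1.2 `&` C i.2.1 i.2.2).
pose good := (\bigcap_n \bigcup_k C n k) `\` bad.
have mgood : measurable good.
  apply: measurableD.
    by apply: bigcapT_measurable => n; exact: bigcupT_measurable.
  by apply: bigcup_countType_measurable => i _; exact: measurableI.
have /choice[psi psiP] t : exists l : E,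
    (good t -> forall n k, C n k t -> m (z k) l <= rad n) /\
    (~ good t -> l = point).
  have [gt|] := pselect (good t); last by exists point.
  have /choice[k kP] n : exists k, C n k t.
    by have [+ _] := gt => /(_ n I)[k _]; exists k.
  have compat n k1 n' k2 : C n k1 t -> C n' k2 t ->
      m (z k1) (z k2) <= rad n + rad n'.
    move=> C1 C2; rewrite leNgt; apply/negP => h; apply: gt.2.
    by exists ((n, k1), (n', k2)).
  (* One selected center per radius gives a Cauchy sequence, by compatibility and since the radii
     tend to 0. Compatibility with far terms then bounds the distance from the limit to every
     selected center. *)
  have [e e0|l kl] := m_complete (u := z \o k).
    have [|N Ne] := rad_small (e := e / 2); first lra.
    exists N => i j Ni Nj /=; have := compat _ _ _ _ (kP i) (kP j).
    by have := Ne _ Ni; have := Ne _ Nj; lra.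
  exists l; split => // _ n j Cnj; apply/ler_addgt0Pr => e e0.
  have e20 : 0 < e / 2 by lra.
  have [N _ Nl] := kl _ ((mE l _).2 (ex_intro2 _ _ (e / 2) e20 (@subset_refl _ _))).
  have [//|p /(_ _ (leq_maxr N p)) pe] := rad_small (e := e / 2).
  have {}Nl := Nl (maxn N p) (leq_maxl _ _).
  have := compat _ _ _ _ Cnj (kP (maxn N p)).
  have := mtri (z j) (z (k (maxn N p))) l; rewrite (msym (z (k (maxn N p))) l).
  by move: Nl => /=; lra.
exists psi; split => [|t x tx].
  apply: measurable_fun_balls => j r.
  (* On [good], [psi t] is closer than r to [z j] exactly when some selected ball has its center
     closer than r minus its radius; off [good], [psi] is constant. *)
  rewrite [X in measurable X](_ : _ =
    (good `&` \bigcup_(i in [set i : nat * nat |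
        m (z j) (z i.2) + rad i.1 < r]) C i.1 i.2) `|`
    (~` good `&` [set _ | m (z j) point < r])).
    apply: measurableU; apply: measurableI => //.
    - by apply: bigcup_countType_measurable => i _.
    - exact: measurableC.
    - have [h|h] := pselect (m (z j) point < r).
        by rewrite [X in measurable X](_ : _ = setT)//; apply/seteqP; split.
      by rewrite [X in measurable X](_ : _ = set0)//; apply/seteqP; split.
  apply/seteqP; split => t /=; last first.
    case=> [[gt [[n k] /= nk Cnk]]|[gt]]; last by rewrite (psiP t).2.
    have := (psiP t).1 gt _ _ Cnk; have := mtri (z j) (z k) (psi t); lra.
  have [gt jr|gt] := pselect (good t); last by rewrite (psiP t).2//; right.
  left; split=> //.
  have [|n /(_ n (leqnn n)) nr] := rad_small (e := (r - m (z j) (psi t)) / 2).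
    lra.
  have [k _ Cnk] := gt.1 n I; exists (n, k) => //=.
  have := (psiP t).1 gt _ _ Cnk; have := mtri (z j) (psi t) (z k).
  by rewrite (msym (psi t)); lra.
(* A code of x is good: by density each radius selects a ball, and two balls that contain x are
   compatible by the triangle inequality. *)
have gt : good t.
  split=> [n _|[[[n k] [n' k']] /= h [/tx h1 /tx h2]]].
    by have [k kx] := z_dense x (rad_gt0 n); exists k => //; apply/tx.
  by have := mtri (z k) x (z k'); rewrite (msym x); lra.
(* Both [psi t] and x are within [rad n] of a common center, for every n. *)
apply/mxx/eqP; rewrite eq_le m0 andbT; apply/ler_addgt0Pr => e e0.
have [|n /(_ n (leqnn n)) ne] := rad_small (e := e / 2); first lra.
have [k kx] := z_dense x (rad_gt0 n).
have := (psiP t).1 gt _ _ ((tx n k).2 kx); have := mtri (psi t) (z k) x.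
by rewrite (msym (psi t) (z k)); lra.
Qed.

End polish_coding.

Lemma polish_dense_seq (R : realType) (E : ptopologicalType) : polish R E ->
  exists (m : E -> E -> R) (z : nat -> E),
    [/\ is_metric m, metrizes m, complete_metric m &
        forall x e, 0 < e -> exists k, m (z k) x < e].
Proof.
move=> [[D cD dD] [m [mm mE mc]]]; have [f finj] := countable_injP _ cD.
have [m0 mxx msym mtri] := mm.
(* The dense set is enumerated by inverting its injection into the naturals; indices outside the
   image get the default [point], which does no harm to density. *)
exists m, (fun k => xget point [set x | D x /\ f x = k]); split => // x e e0.
have [|y [/= xy Dy]] := dD [set y | m x y < e] _ (metric_ball_open mm mE x e).
  by exists x; rewrite /= (mxx x x).2.
exists (f y); case: xgetP => [w -> [Dw fw]|/(_ y)[]//].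
by rewrite (finj _ _ _ _ fw) ?inE// msym.
Qed.

Lemma polish_coding (R : realType) (E : ptopologicalType) : polish R E ->
  exists (phi : borel E -> R) (psi : R -> borel E),
    [/\ measurable_fun [set: borel E] phi, forall x, 0 <= phi x <= 1,
        measurable_fun [set: R] psi & cancel phi psi].
Proof.
move=> /polish_dense_seq[m [z [mm mE mc zd]]].
(* Digit number [pickle (n, k)] of the code of y records whether y lies in the ball of radius
   1/(n+1) about [z k]; indices that code no pair get the empty set. *)
pose B i : set (borel E) := if unpickle i is Some (n, k) then
  [set y | m (z k) y < n.+1%:R^-1] else set0.
have [i|phi [C [mphi phi01 mC CB]]] := @real_coding R _ _ B.
  rewrite /B; case: unpickle => [[n k]|//].
  by apply: sub_sigma_algebra; exact: metric_ball_open.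
have [n|e e0|//|psi [mpsi psiP]] := polish_decoding mm mE zd
  (rad := fun n => n.+1%:R^-1) _ _ mc
  (C := fun n k => C (pickle (n, k))).
- by rewrite invr_gt0.
- have [N _ Ne] := near_infty_natSinv_lt (PosNum e0).
  by exists N => n; exact: Ne.
exists phi, psi; split => // x; apply: psiP => n k.
by rewrite CB /B pickleK.
Qed.

(** * Conditional quantiles *)

Section conditional_cdf.
Local Open Scope ereal_scope.
Context d (T : measurableType d) (R : realType).

(** On the set where g < f the difference f - g is positive, yet its integral there is at most 0, so
    it vanishes almost everywhere on that set. *)
Lemma negligible_gt_integral (mu : {measure set T -> \bar R}) (f g : T -> \bar R) :
  mu.-integrable [set: T] f -> mu.-integrable [set: T] g ->
  (forall A, measurable A -> \int[mu]_(x in A) f x <= \int[mu]_(x in A) g x) ->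
  mu.-negligible [set x | g x < f x].
Proof.
move=> intf intg fg; set A := [set x | g x < f x].
have mf : measurable_fun [set: T] f by exact: measurable_int intf.
have mg : measurable_fun [set: T] g by exact: measurable_int intg.
have mA : measurable A by rewrite -[A]setTI; exact: measurable_lte.
have iA h : mu.-integrable [set: T] h -> mu.-integrable A h.
  by move=> ih; exact: integrableS ih.
have fgA x : A x -> 0 <= f x - g x by move=> Ax; rewrite ltW// sube_gt0.
have : \int[mu]_(x in A) `|(f \- g) x| = 0.
  rewrite (eq_integral (f \- g)); last first.
    by move=> x /[!inE] Ax; rewrite gee0_abs//= fgA.
  apply/eqP; rewrite eq_le andbC integral_ge0//=.
  rewrite integralB//; [|exact: iA|exact: iA].
  by rewrite sube_le0; exact: fg.
move/(ae_eq_integral_abs mu mA (f := f \- g)) => [].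
  by apply: measurable_funTS; exact: emeasurable_funB.
move=> N [mN N0 subN]; exists N; split=> // x Ax; apply: subN => /= /(_ Ax) h.
by have := Ax; rewrite /A/= -sube_gt0 h ltxx.
Qed.

Lemma negligible_bigcup_countType (mu : {measure set T -> \bar R}) (I : countType)
    (F : I -> set T) : (forall i, mu.-negligible (F i)) ->
  mu.-negligible (\bigcup_i F i).
Proof.
move=> nF; apply: (negligibleS _ (negligible_bigcup
  (F := fun n => if unpickle n is Some i then F i else set0) _)).
  by move=> x [i _ Fix]; exists (pickle i) => //; rewrite pickleK.
by move=> n; case: unpickle => [i|]; [exact: nF|exact: negligible_set0].
Qed.

(** Each F q is a density of [nu q] with respect to [mu]. The bound by 1 and each comparison of two
    densities hold off a null set; as the indices are rational, one null set N serves for all of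
    them. *)
Lemma conditional_cdf (mu : {finite_measure set T -> \bar R})
    (nu : rat -> {finite_measure set T -> \bar R}) :
  (forall p q A, (p <= q)%R -> measurable A -> nu p A <= nu q A) ->
  (forall q A, measurable A -> nu q A <= mu A) ->
  exists F : rat -> T -> R,
    [/\ forall q, measurable_fun [set: T] (F q),
        forall q x, (0 <= F q x <= 1)%R,
        forall x p q, (p <= q)%R -> (F p x <= F q x)%R &
        forall q A, measurable A -> nu q A = \int[mu]_(x in A) (F q x)%:E].
Proof.
move=> nu_mono nu_mu.
have /choice[f fP] q : exists f : T -> \bar R, [/\ forall x, f x >= 0,
    forall x, f x \is a fin_num, mu.-integrable [set: T] f &
    forall A, measurable A -> nu q A = \int[mu]_(x in A) f x].
  apply: radon_nikodym_sigma_finite; apply/null_content_dominatesP => A mA muA.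
  by apply/eqP; rewrite -measure_le0 -muA; exact: nu_mu.
pose H (i : rat * rat) := [set x | 1 < f i.1 x] `|`
  (if (i.1 <= i.2)%R then [set x | f i.2 x < f i.1 x] else set0).
have /negligible_bigcup_countType[N [mN N0 HN]] i : mu.-negligible (H i).
  have [_ _ fi1 nui1] := fP i.1; have [_ _ fi2 nui2] := fP i.2.
  apply: negligibleU; last first.
    case: ifPn => [i12|_]; last exact: negligible_set0.
    apply: negligible_gt_integral => // A mA.
    by rewrite -nui1// -nui2//; exact: nu_mono.
  apply: (@negligible_gt_integral _ _ (cst 1)) => // [|A mA].
    by apply: finite_measure_integrable_cst.
  by rewrite -nui1// integral_cst// mul1e; exact: nu_mu.
(* Setting all densities to 0 on N makes the bounds and the monotonicity hold at every point and
   leaves the integrals unchanged. *)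
exists (fun q x => fine (f q x) * \1_(~` N) x)%R.
have mF q : measurable_fun [set: T] (fun x => fine (f q x) * \1_(~` N) x)%R.
  apply: measurable_funM.
    have [_ _ /measurable_int mfq _] := fP q.
    by apply: measurableT_comp mfq; exact: fine_measurable.
  by apply: measurable_indic; exact: measurableC.
have FN q x : N x -> (fine (f q x) * \1_(~` N) x = 0)%R.
  by move=> Nx; rewrite indicE memNset ?mulr0//=; apply.
have FC q x : ~ N x -> (fine (f q x) * \1_(~` N) x = fine (f q x))%R.
  by move=> Nx; rewrite indicE mem_set ?mulr1.
split => // [q x|x p q pq|q A mA].
- have [f0 ffin _ _] := fP q; have [/FN->|Nx] := pselect (N x).
    by rewrite lexx ler01.
  rewrite FC// fine_ge0//= -lee_fin fineK// leNgt; apply/negP => h; apply: Nx.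
  by apply: HN; exists (q, q) => //; left.
- have [_ ffinp _ _] := fP p; have [_ ffinq _ _] := fP q.
  have [Nx|Nx] := pselect (N x); first by rewrite !FN.
  rewrite !FC// fine_le// leNgt; apply/negP => h; apply: Nx.
  by apply: HN; exists (p, q) => //; right; rewrite /= pq.
- have [f0 ffin intf ->] := fP q => //.
  apply: ae_eq_integral => //.
  + by apply: measurable_funTS; exact: measurable_int intf.
  + by apply: measurable_funTS; apply/measurable_EFinP.
  + exists N; split => // x /= h; apply: contrapT => Nx; apply: h => _.
    by rewrite FC// fineK.
Qed.

End conditional_cdf.

Lemma rat_seq_cvg_left (R : realType) (t : R) : 0 < t ->
  exists q : nat -> rat, [/\ forall n, 0 <= q n, forall n, ratr (q n) < t,
    nondecreasing_seq q & forall x, x < t -> exists n, x < ratr (q n)].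
Proof.
move=> t0.
have /choice[r rP] n : exists q : rat,
    Num.max 0 (t - n.+1%:R^-1) < ratr q /\ ratr q < t.
  have [|q] := @rat_in_itvoo R (Num.max 0 (t - n.+1%:R^-1)) t.
    by rewrite gt_max t0 ltrBlDr ltrDl invr_gt0/=.
  by rewrite in_itv/= => /andP[]; exists q.
(* Running maxima make the approximations monotone while keeping them below t. *)
pose q := fix q n := if n is n'.+1 then Num.max (q n') (r n'.+1) else r 0%N.
have rq n : r n <= q n by case: n => [//|n] /=; rewrite le_max lexx orbT.
exists q; split.
- move=> n; apply: le_trans (rq n); rewrite -(@ler0q R).
  by have [/ltW] := rP n; rewrite ge_max => /andP[].
- elim=> [|n IHn] /=; first by have [] := rP 0%N.
  by rewrite /Order.max; case: ifP => _ //; have [] := rP n.+1.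
- by apply/nondecreasing_seqP => n /=; rewrite le_max lexx.
- move=> x xt; have tx0 : 0 < t - x by rewrite subr_gt0.
  have [n _ /(_ n (leqnn n))/= nx] := near_infty_natSinv_lt (PosNum tx0).
  exists n; have [+ _] := rP n; rewrite gt_max => /andP[_ h].
  have rqn : ratr (r n) <= ratr (q n) :> R by rewrite ler_rat.
  apply: lt_le_trans rqn.
  by apply: lt_trans h; rewrite ltrBrDr -ltrBrDl.
Qed.

Lemma uniform_prob_le (R : realType) (x : R) : 0 <= x <= 1 ->
  uniform_prob (@ltr01 R) [set u | u <= x] = x%:E.
Proof.
move=> /andP[x0 x1]; rewrite /uniform_prob integral_uniform_pdf.
rewrite [X in (\int[_]_(_ in X) _)%E](_ : _ = `[0, x]%classic); last first.
  apply/seteqP; split => u /=; rewrite !in_itv/=; first by case=> -> /andP[->].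
  by move=> /andP[-> ux]; rewrite (le_trans ux).
rewrite (eq_integral (cst 1%E)); last first.
  move=> u; rewrite inE/= in_itv/= => /andP[u0 ux].
  by rewrite /uniform_pdf u0 (le_trans ux)//= subr0 invr1.
rewrite integral_cst//= mul1e lebesgue_measure_itv/= lte_fin.
case: ltP => [_|h]; first by rewrite oppr0 addr0.
by congr (_%:E); apply: le_anti; rewrite h x0.
Qed.

Section quantile.
Context d (T : measurableType d) (R : realType).
Variable F : rat -> T -> R.
Hypothesis mF : forall q, measurable_fun [set: T] (F q).

(** The generalized inverse of q |-> F q x at level u, for p = (x, u). The extra element 1 keeps the
    set nonempty and q >= 0 bounds it below, so the values lie in [0, 1]. *)
Definition quantile (p : T * R) : R :=
  inf [set x | x = 1 \/ exists q : rat, [/\ 0 <= q, x = ratr q & p.2 <= F q p.1]].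

Lemma quantile_ge0 p : 0 <= quantile p.
Proof.
apply: lb_le_inf; first by exists 1; left.
by move=> x [->|[q [q0 -> _]]]; rewrite ?ler01// ler0q.
Qed.

Lemma quantile_has_lbound (p : T * R) : has_lbound
  [set x : R | x = 1 \/ exists q : rat, [/\ 0 <= q, x = ratr q & p.2 <= F q p.1]].
Proof. by exists 0 => x [->|[q [q0 -> _]]]; rewrite ?ler01// ler0q. Qed.

Lemma quantile_le1 p : quantile p <= 1.
Proof. by apply: ge_inf; [exact: quantile_has_lbound|left]. Qed.

(** An infimum is below t exactly when some element is, which gives a union over rationals; t <= 1
    rules out the extra element 1. *)
Lemma quantile_lt t : t <= 1 -> [set p | quantile p < t] =
  \bigcup_(q in [set q : rat | 0 <= q /\ ratr q < t]) [set p | p.2 <= F q p.1].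
Proof.
move=> t1; apply/seteqP; split => p /=.
  move=> /inf_lt[|x [->|[q [q0 -> qp]]] xt]; first by exists 1; left.
    by move: t1; rewrite leNgt xt.
  by exists q.
move=> [q /= [q0 qt] qp]; apply: le_lt_trans qt; apply: ge_inf.
  exact: quantile_has_lbound.
by right; exists q.
Qed.

Lemma measurable_quantile_layer q : measurable [set p : T * R | p.2 <= F q p.1].
Proof.
rewrite -[X in measurable X]setTI -[X in _ `&` X]preimage_true.
apply: measurable_fun_ler => //.
by apply: (measurableT_comp (mF q)); exact: measurable_fst.
Qed.

Lemma measurable_quantile : measurable_fun [set: T * R] quantile.
Proof.
apply: (measurability _ (RGenInftyO.measurableE R)) => _ [_ [t ->] <-].
rewrite setTI preimage_itvNyo; have [t1|t1] := leP t 1.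
  rewrite quantile_lt//; apply: bigcup_countType_measurable => q _.
  exact: measurable_quantile_layer.
rewrite [X in measurable X](_ : _ = setT)//; apply/seteqP; split => // p _ /=.
exact: le_lt_trans (quantile_le1 p) t1.
Qed.

End quantile.

(** * Reproducing a joint law from independent uniform noise *)

Section joint_law.
Context d (T : measurableType d) d' (O : measurableType d') (R : realType).
Variables (P : probability O R) (Y : {mfun O >-> T}).
Variables (D : set O) (mD : measurable D).

(** The finite measure A |-> P(Y in A, D) for a fixed event D. It serves both as the measure to be
    differentiated against the law of Y and, with the roles exchanged, in the uniqueness of joint
    laws. *)
Definition joint_law : set T -> \bar R := pushforward (mrestr P mD) Y.

Let joint_law0 : joint_law set0 = 0%E.
Proof. exact: measure0. Qed.

Let joint_law_ge0 A : (0 <= joint_law A)%E.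
Proof. exact: measure_ge0. Qed.

Let joint_law_sigma_additive : semi_sigma_additive joint_law.
Proof. exact: measure_semi_sigma_additive. Qed.

HB.instance Definition _ := isMeasure.Build _ _ _ joint_law
  joint_law0 joint_law_ge0 joint_law_sigma_additive.

Lemma joint_law_fin : fin_num_fun joint_law.
Proof.
move=> A mA; rewrite /joint_law /pushforward /mrestr.
apply: fin_num_measure; apply: measurableI => //.
by rewrite -[X in measurable X]setTI; exact: measurable_funP.
Qed.

HB.instance Definition _ := Measure_isFinite.Build _ _ _ joint_law joint_law_fin.

End joint_law.

Section noise_outsourcing.
Context d (T : measurableType d) d' (O : measurableType d') (R : realType).
Variables (P : probability O R) (Y : {mfun O >-> T}).
Local Open Scope ereal_scope.

(** With F q the conditional probability of W < q given Y, a uniform u satisfies u <= F q y with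
    probability F q y. Integrating over y in A yields P(Y in A, W < q), so Q is the quantile
    function of F. *)
Lemma noise_outsourcing (W : O -> R) : measurable_fun [set: O] W ->
  (forall w, (0 <= W w <= 1)%R) ->
  exists d'' (N : measurableType d'') (U : probability N R),
  exists2 Q : T * N -> R, measurable_fun [set: T * N] Q &
    forall A t, measurable A ->
      (distribution P Y \x U) [set p | A p.1 /\ (Q p < t)%R] =
      P [set w | A (Y w) /\ (W w < t)%R].
Proof.
move=> mW W01.
have mY A : measurable A -> measurable (Y @^-1` A).
  by move=> mA; rewrite -[X in measurable X]setTI; exact: measurable_funP.
have mWt (t : R) : measurable [set w | (W w < t)%R].
  rewrite -[X in measurable X]setTI -preimage_itvNyo.
  by apply: mW => //; exact: measurable_itv.
have PS A B : measurable A -> measurable B -> A `<=` B -> P A <= P B.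
  by move=> mA mB AB; apply: le_measure => //; rewrite inE.
have [p q A pq mA|q A mA|F [mF F01 Fmono FE]] := @conditional_cdf _ T R
  (distribution P Y) (fun q => joint_law P Y (mWt (ratr q))).
- apply: PS; [exact: measurableI (mY _ mA) _|exact: measurableI (mY _ mA) _|].
  by move=> w [Aw /= Ww]; split=> //; apply: lt_le_trans Ww _; rewrite ler_rat.
- by apply: PS; [exact: measurableI (mY _ mA) _|exact: mY|move=> w []].
exists _, _, (uniform_prob (@ltr01 R)), (quantile F).
  exact: measurable_quantile.
move=> A t mA.
(* Both W and the quantile take values in [0, 1]: for t <= 0 both events are empty, and for t > 1
   the condition involving t always holds. *)
have [t0|t0] := leP t 0%R.
  rewrite [X in _ = P X](_ : _ = set0) ?measure0; last first.
    apply/seteqP; split => // w [_ /lt_le_trans/(_ t0)].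
    by have /andP[/le_lt_trans + _] := W01 w => /[apply]; rewrite ltxx.
  rewrite [X in _ X = _](_ : _ = set0) ?measure0//.
  apply/seteqP; split => // p [_ /lt_le_trans/(_ t0)].
  by move=> /(le_lt_trans (quantile_ge0 F p)); rewrite ltxx.
have [t1|t1] := ltP 1%R t.
  rewrite [X in _ = P X](_ : _ = Y @^-1` A); last first.
    apply/seteqP; split => w /= => [[]//|Aw]; split => //.
    by have /andP[_ /le_lt_trans] := W01 w; exact.
  rewrite [X in _ X = _](_ : _ = A `*` setT); last first.
    apply/seteqP; split => p /= [Ap _]; split => //.
    exact: le_lt_trans (quantile_le1 F p) t1.
  by rewrite product_measure1E//= [X in _ * X]probability_setT mule1.
(* Both events are increasing unions along rationals tending to t from below, so continuity from
   below reduces the claim to rational thresholds. *)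
have [q [q0 qt qnd qP]] := rat_seq_cvg_left t0.
pose S n := [set p : T * R | A p.1 /\ (p.2 <= F (q n) p.1)%R].
have -> : [set p | A p.1 /\ (quantile F p < t)%R] = \bigcup_n S n.
  apply/seteqP; split => [p [Ap]|p [n _ [Ap Fp]]]; last first.
    split => //; change ([set p | (quantile F p < t)%R] p).
    by rewrite quantile_lt//; exists (q n).
  move=> h; have : [set p | (quantile F p < t)%R] p by [].
  rewrite quantile_lt// => -[r /= [r0 /qP[n rn] rp]].
  exists n => //; split => //; apply: le_trans rp _; apply: Fmono.
  by rewrite -(@ler_rat R) ltW.
pose V n := [set w | A (Y w) /\ (W w < ratr (q n))%R].
have -> : [set w | A (Y w) /\ (W w < t)%R] = \bigcup_n V n.
  apply/seteqP; split => [w [Aw /qP[n wn]]|w [n _ [Aw wn]]]; first by exists n.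
  by split => //; exact: lt_trans wn (qt n).
have mS n : measurable (S n).
  rewrite (_ : S n = (fst @^-1` A) `&` [set p | (p.2 <= F (q n) p.1)%R])//.
  apply: measurableI; last exact: measurable_quantile_layer.
  by rewrite -[X in measurable X]setTI; exact: measurable_fst.
have mV n : measurable (V n) by exact: measurableI (mY _ mA) (mWt _).
have SV n : (distribution P Y \x uniform_prob (@ltr01 R)) (S n) = P (V n).
  (* The section of [S n] at x is the set of u at most F (q n) x if A holds at x, and is empty
     otherwise. *)
  rewrite [RHS](FE (q n) _ mA) /product_measure1 [RHS]integral_mkcond.
  apply: eq_integral => x _; rewrite patchE/=; case: ifPn => [/set_mem Ax|].
    rewrite -(uniform_prob_le (F01 (q n) x)); congr (uniform_prob _ _).
    apply/seteqP; split => u; rewrite /xsection /= inE.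
      by case.
    by split.
  move=> /negP Ax; rewrite [X in uniform_prob _ X](_ : _ = set0) ?measure0//.
  apply/seteqP; split => u //; rewrite /xsection /= inE => -[Ax' _].
  by apply: Ax; rewrite inE.
have cS : (distribution P Y \x uniform_prob (@ltr01 R)) \o S @ \oo -->
    (distribution P Y \x uniform_prob (@ltr01 R)) (\bigcup_n S n).
  apply: nondecreasing_cvg_mu => //; first exact: bigcupT_measurable.
  move=> n k nk; apply/subsetPset => p [Ap /le_trans Fp]; split => //.
  by apply: Fp; apply: Fmono; exact: qnd.
have cV : P \o V @ \oo --> P (\bigcup_n V n).
  apply: nondecreasing_cvg_mu => //; first exact: bigcupT_measurable.
  move=> n k nk; apply/subsetPset => w [Aw /lt_le_trans Vw]; split => //.
  by apply: Vw; rewrite ler_rat; exact: qnd.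
rewrite -(cvg_lim _ cS)// -(cvg_lim _ cV)//; congr (lim (_ @ \oo)).
by apply/funext => n; exact: SV.
Qed.

End noise_outsourcing.
(** * Gluing *)

Definition mfun_pack d d' (T1 : measurableType d) (T2 : measurableType d')
    (f : T1 -> T2) (mf : measurable_fun [set: T1] f) : {mfun T1 >-> T2} :=
  HB.pack f (isMeasurableFun.Build _ _ _ _ f mf).

Lemma measurable_preimage d d' (T1 : measurableType d) (T2 : measurableType d')
    (f : T1 -> T2) (A : set T2) :
  measurable_fun [set: T1] f -> measurable A -> measurable (f @^-1` A).
Proof. by move=> mf mA; rewrite -[X in measurable X]setTI; exact: mf. Qed.

(** Two successive uniqueness arguments on pi-systems: first rectangles A x B generate the product,
    then, for fixed A, open left rays generate the Borel sets B. *)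
Lemma pair_law_unique d (T : measurableType d) (R : realType)
    d1 (O1 : measurableType d1) (P1 : probability O1 R) (Y1 : O1 -> T) (W1 : O1 -> R)
    d2 (O2 : measurableType d2) (P2 : probability O2 R) (Y2 : O2 -> T) (W2 : O2 -> R) :
  measurable_fun [set: O1] Y1 -> measurable_fun [set: O1] W1 ->
  measurable_fun [set: O2] Y2 -> measurable_fun [set: O2] W2 ->
  (forall A t, measurable A ->
    P1 [set w | A (Y1 w) /\ W1 w < t] = P2 [set w | A (Y2 w) /\ W2 w < t]) ->
  forall C : set (T * R), measurable C ->
    P1 [set w | C (Y1 w, W1 w)] = P2 [set w | C (Y2 w, W2 w)].
Proof.
move=> mY1 mW1 mY2 mW2 h.
pose V1 := mfun_pack (measurable_fun_pair mY1 mW1).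
pose V2 := mfun_pack (measurable_fun_pair mY2 mW2).
apply: (measure_unique [set A `*` B | A in measurable & B in measurable]
  (fun=> setT) _ _ _ _ (distribution P1 V1) (distribution P2 V2)).
- exact: measurable_prod_measurableType.
- move=> _ _ [A mA [B mB <-]] [A' mA' [B' mB' <-]].
  exists (A `&` A'); first exact: measurableI.
  by exists (B `&` B'); [exact: measurableI|rewrite setXI].
- by move=> _; exists setT => //; exists setT => //; rewrite setXTT.
- exact: bigcup_const.
- move=> _ [A mA [B mB <-]].
  have mA1 := measurable_preimage mY1 mA; have mA2 := measurable_preimage mY2 mA.
  have e1 : distribution P1 V1 (A `*` B) = joint_law P1 (mfun_pack mW1) mA1 B.
    by congr (P1 _); apply/seteqP; split => w [].
  have e2 : distribution P2 V2 (A `*` B) = joint_law P2 (mfun_pack mW2) mA2 B.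
    by congr (P2 _); apply/seteqP; split => w [].
  rewrite [LHS]e1 [RHS]e2.
  apply: (measure_unique (@RGenInftyO.G R) (fun k => `]-oo, k%:R[%classic)
    _ _ _ _ (joint_law P1 (mfun_pack mW1) mA1)
    (joint_law P2 (mfun_pack mW2) mA2)) => //.
  + exact: RGenInftyO.measurableE.
  + move=> _ _ [x ->] [y ->]; exists (Num.min x y).
    by apply/seteqP; split => z /=; rewrite !in_itv/= lt_min => /andP.
  + by move=> k; exists k%:R.
  + apply/seteqP; split => // x _; exists (Num.truncn x).+1 => //=.
    by rewrite in_itv/= truncnS_gt.
  + move=> _ [t ->]; have j1 : P1 (W1 @^-1` `]-oo, t[ `&` Y1 @^-1` A) =
        P1 [set w | A (Y1 w) /\ W1 w < t].
      by congr (P1 _); apply/seteqP; split => w /=; rewrite in_itv/= => -[].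
    have j2 : P2 (W2 @^-1` `]-oo, t[ `&` Y2 @^-1` A) =
        P2 [set w | A (Y2 w) /\ W2 w < t].
      by congr (P2 _); apply/seteqP; split => w /=; rewrite in_itv/= => -[].
    exact: etrans j1 (etrans (h A t mA) (esym j2)).
  + by move=> k; rewrite ltey_eq fin_num_measure//; exact: measurable_itv.
- by move=> _; rewrite ltey_eq fin_num_measure.
Qed.

(** The U-measure of the section of B at y is integrated against the law of the first coordinate,
    and the two laws agree. This moves the noise construction from the second space to the first. *)
Lemma product_law_eq d (T : measurableType d) (R : realType)
    d1 (O1 : measurableType d1) (P1 : probability O1 R) (Y1 : {mfun O1 >-> T})
    d2 (O2 : measurableType d2) (P2 : probability O2 R) (Y2 : {mfun O2 >-> T})
    d3 (O3 : measurableType d3) (U : probability O3 R) :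
  (forall A, measurable A -> distribution P1 Y1 A = distribution P2 Y2 A) ->
  forall B : set (T * O3), measurable B ->
    (P1 \x U)%E [set w | B (Y1 w.1, w.2)] = (distribution P2 Y2 \x U)%E B.
Proof.
move=> law B mB; have mU := measurable_fun_xsection U mB.
rewrite /product_measure1 [RHS](eq_measure_integral (distribution P1 Y1)); last first.
  by move=> A mA _; rewrite [RHS]law.
by rewrite ge0_integral_distribution.
Qed.

(* The third variable is a function of the second one and of an independent
   uniform variable, so that no disintegration of measures is needed. *)
Lemma gluing (R : realType) (E : ptopologicalType) d (T : measurableType d)
    d1 (O1 : measurableType d1) (P1 : probability O1 R) (Y1 : {mfun O1 >-> T})
    d2 (O2 : measurableType d2) (P2 : probability O2 R) (Y2 : {mfun O2 >-> T})
    (Z2 : {mfun O2 >-> borel E}) :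
  polish R E ->
  (forall A, measurable A -> distribution P1 Y1 A = distribution P2 Y2 A) ->
  exists d3 (N : measurableType d3) (U : probability N R)
      (Z1 : {mfun (O1 * N)%type >-> borel E}),
    forall B : set (T * borel E), measurable B ->
      (P1 \x U)%E [set w | B (Y1 w.1, Z1 w)] =
      P2 [set w | B (Y2 w, Z2 w)].
Proof.
move=> /polish_coding[phi [psi [mphi phi01 mpsi phiK]]] law.
have mW : measurable_fun [set: O2] (phi \o Z2) by exact: measurableT_comp.
have [w|d3 [N [U [Q mQ QP]]]] := noise_outsourcing P2 Y2 mW.
  exact: phi01.
have mY : measurable_fun [set: O1 * N] (fun w => Y1 w.1).
  by apply: measurableT_comp => //; exact: measurable_fst.
have mQY : measurable_fun [set: O1 * N] (fun w => Q (Y1 w.1, w.2)).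
  by apply: measurableT_comp => //; exact: measurable_fun_pair.
have mZ : measurable_fun [set: O1 * N] (fun w => psi (Q (Y1 w.1, w.2))).
  exact: measurableT_comp.
exists d3, N, U, (mfun_pack mZ) => B mB.
have := @pair_law_unique _ _ _ _ _ (P1 \x U)%E
  _ _ _ _ P2 _ _ mY mQY (@measurable_funP _ _ _ _ _ Y2) mW.
(* The law of (Y2, phi Z2) is reproduced on the first space; decoding by [psi], a left inverse of
   [phi], then recovers that of (Y2, Z2). *)
move=> /(_ _ [set p | B (p.1, psi p.2)]) ->.
- by congr (P2 _); apply/seteqP; split => w /=; rewrite phiK.
- move=> A t mA; rewrite -[RHS]QP//.
  suff mAQ : measurable [set p : T * N | A p.1 /\ Q p < t].
    exact: (product_law_eq U law mAQ).
  rewrite (_ : [set p | _] = fst @^-1` A `&` Q @^-1` `]-oo, t[%classic).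
    apply: measurableI; apply: measurable_preimage => //.
  by apply/seteqP; split => p /=; rewrite in_itv.
- rewrite (_ : [set p | _] = (fun p => (p.1, psi p.2)) @^-1` B)//.
  apply: measurable_preimage => //; apply: measurable_fun_pair => //.
  exact: measurableT_comp.
Qed.

(** * Optimal transport *)

Section borel_product.
Context {R : realType} {E : ptopologicalType}.
Hypothesis hE : polish R E.

(** Balls of rational radius about a dense sequence form a countable base, so an open set of the
    product is a countable union of rectangles of such balls. *)
Lemma open_measurable_prod (A : set (E * E)) :
  open A -> measurable (A : set (borel E * borel E)%type).
Proof.
have [m [z [mm mE _ zd]]] := polish_dense_seq hE; have [_ mxx _ mtri] := mm.
move=> oA; pose b (i : nat * rat) : set E := [set y | m (z i.1) y < ratr i.2].
have bopen i : open (b i) by exact: metric_ball_open.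
have bsmall x V : nbhs x V -> exists2 i, b i x & b i `<=` V.
  move=> /(mE x)[r r0 rV].
  have [|q] := @rat_in_itvoo R 0 (r / 2); first lra.
  rewrite in_itv/= => /andP[q0 qr]; have [k kx] := zd x _ q0.
  exists (k, q) => //= y /= ky; apply: rV => /=.
  have [_ _ msym _] := mm.
  by have := mtri x (z k) y; rewrite (msym x (z k)); rewrite /b /= in ky; lra.
have -> : A = \bigcup_(ij in [set ij : (nat * rat) * (nat * rat) |
    b ij.1 `*` b ij.2 `<=` A]) (b ij.1 `*` b ij.2).
  apply/seteqP; split => [[x y] Axy|p [ij /= ijA]]; last exact: ijA.
  have /= : nbhs (x, y) A by move: oA; rewrite openE; exact.
  move=> [[U V] [/= /bsmall[i ix iU] /bsmall[j jy jV]] UVA].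
  exists (i, j) => //= -[u v] [/= /iU Uu /jV Vv]; exact: UVA.
apply: bigcup_countType_measurable => ij _; apply: measurableX;
  by apply: sub_sigma_algebra; exact: bopen.
Qed.

(** Passes from the Borel sets of the product space, where [d] is measurable, to the product
    sigma-algebra, where pairs of random variables are measurable. *)
Lemma measurable_borel_prod (f : E * E -> R) :
  measurable_fun [set: borel (E * E)%type] f ->
  measurable_fun [set: borel E * borel E] f.
Proof.
move=> mf _ B mB; rewrite setTI.
have : measurable (f @^-1` B : set (borel (E * E)%type)).
  exact: measurable_preimage mf mB.
apply: smallest_sub; first exact: sigma_algebra_measurable.
exact: open_measurable_prod.
Qed.

Lemma lower_semicontinuous_measurable_prod (f : E * E -> R) :
  lower_semicontinuous (EFin \o f) -> measurable_fun [set: borel E * borel E] f.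
Proof.
move=> /lower_semicontinuousP fo.
apply: (measurability _ (RGenOInfty.measurableE R)) => _ [_ [t ->] <-].
rewrite setTI preimage_itvoy; apply: open_measurable_prod.
by under eq_set do rewrite -lte_fin; exact: fo.
Qed.

End borel_product.

(** * Couplings and the triangle inequality for transport costs *)

Section optimal_transport_theory.
Context {R : realType} {E : ptopologicalType}.
Implicit Types (c : E -> E -> R) (X Y Z : rvar R E).
Local Open Scope ereal_scope.

Lemma same_law_refl X : same_law (RVar (rv_prob X) (rv_fun X)) X.
Proof. by []. Qed.

Lemma OT_ge0 c X Y : (forall x y, (0 <= c x y)%R) -> 0 <= OT c X Y.
Proof.
move=> c0; apply: le_ereal_inf_tmp => _ [d [Om [P [X' [Y' [_ _ ->]]]]]].
by rewrite unlock; apply: integral_ge0 => w _; rewrite lee_fin.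
Qed.

Lemma OT_le_coupling c X Y d (O : measurableType d) (P : probability O R)
    (X' Y' : {mfun O >-> borel E}) :
  same_law (RVar P X') X -> same_law (RVar P Y') Y ->
  OT c X Y <= 'E_P[fun w => c (X' w) (Y' w)].
Proof. by move=> lX lY; apply: ereal_inf_lbound; exists d, O, P, X', Y'. Qed.

Lemma OT_sym c X Y : (forall x y, c x y = c y x) -> OT c X Y = OT c Y X.
Proof.
move=> csym; congr ereal_inf; apply/seteqP.
split=> _ [d [Om [P [X' [Y' [lX lY ->]]]]]]; exists d, Om, P, Y', X'; split => //;
  by congr ('E_P[_]); apply/funext => w; exact: csym.
Qed.

Section cost.
Variable c : E -> E -> R.
Hypothesis c_ge0 : forall x y, (0 <= c x y)%R.
Hypothesis c_meas :
  measurable_fun [set: borel E * borel E] (fun p => c p.1 p.2 : R).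

Lemma measurable_cost d (O : measurableType d) (f g : O -> borel E) :
  measurable_fun [set: O] f -> measurable_fun [set: O] g ->
  measurable_fun [set: O] (fun w => c (f w) (g w)).
Proof.
by move=> mf mg; exact: (measurableT_comp c_meas (measurable_fun_pair mf mg)).
Qed.

Lemma expectation_pair_law d1 (O1 : measurableType d1) (P1 : probability O1 R)
    d2 (O2 : measurableType d2) (P2 : probability O2 R)
    (X1 Y1 : O1 -> borel E) (X2 Y2 : O2 -> borel E) :
  measurable_fun [set: O1] X1 -> measurable_fun [set: O1] Y1 ->
  measurable_fun [set: O2] X2 -> measurable_fun [set: O2] Y2 ->
  (forall B : set (borel E * borel E), measurable B ->
    P1 [set w | B (X1 w, Y1 w)] = P2 [set w | B (X2 w, Y2 w)]) ->
  'E_P1[fun w => c (X1 w) (Y1 w)] = 'E_P2[fun w => c (X2 w) (Y2 w)].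
Proof.
move=> mX1 mY1 mX2 mY2 law; rewrite unlock.
pose V1 := mfun_pack (measurable_fun_pair mX1 mY1).
pose V2 := mfun_pack (measurable_fun_pair mX2 mY2).
have mc : measurable_fun [set: borel E * borel E] (fun p => (c p.1 p.2)%:E).
  by apply/measurable_EFinP.
have cE p : 0 <= (c p.1 p.2)%:E by rewrite lee_fin.
rewrite -[LHS](ge0_integral_distribution (P := P1) V1 mc cE).
rewrite -[RHS](ge0_integral_distribution (P := P2) V2 mc cE).
by apply: eq_measure_integral => B mB _; exact: law.
Qed.

(** Couplings of (X, Y) and (Y, Z), each optimal up to e/2, are glued along Y; the pointwise
    triangle inequality is then integrated. *)
Lemma OT_triangle X Y Z : polish R E ->
  (forall x y z, (c x z <= c x y + c y z)%R) ->
  OT c X Z <= OT c X Y + OT c Y Z.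
Proof.
move=> hE ctri; have [fXY|] := boolP (OT c X Y \is a fin_num); last first.
  rewrite fin_numElt (lt_le_trans (ltNyr 0) (OT_ge0 _ _ c_ge0))/=.
  rewrite -leNgt leye_eq => /eqP ->; rewrite addye ?leey//.
  by rewrite gt_eqF// (lt_le_trans (ltNyr 0) (OT_ge0 _ _ c_ge0)).
have [fYZ|] := boolP (OT c Y Z \is a fin_num); last first.
  rewrite fin_numElt (lt_le_trans (ltNyr 0) (OT_ge0 _ _ c_ge0))/=.
  rewrite -leNgt leye_eq => /eqP ->; rewrite addey ?leey//.
  by rewrite gt_eqF// (lt_le_trans (ltNyr 0) (OT_ge0 _ _ c_ge0)).
apply/lee_addgt0Pr => e e0; have e20 : (0 < e / 2)%R by rewrite divr_gt0.
have [_ [d1 [Om1 [P1 [X1 [Y1 [lX1 lY1 ->]]]]]] h1] :=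
  lb_ereal_inf_adherent e20 fXY.
have [_ [d2 [Om2 [P2 [Y2 [Z2 [lY2 lZ2 ->]]]]]] h2] :=
  lb_ereal_inf_adherent e20 fYZ.
have law A : measurable A -> distribution P1 Y1 A = distribution P2 Y2 A.
  by move=> mA; rewrite [LHS](lY1 A mA) -(lY2 A mA).
have [d3 [N [U [Z1 lawZ]]]] := gluing Z2 hE law.
pose P : probability (Om1 * N)%type R := P1 \x U.
have mfst (f : {mfun Om1 >-> borel E}) :
    measurable_fun [set: Om1 * N] (fun w => f w.1).
  by apply: measurableT_comp => //; exact: measurable_fst.
(* The noise has total mass 1, so variables that ignore it keep their joint law. *)
have lawfst A : measurable A -> P (fst @^-1` A) = P1 A.
  move=> mA; rewrite (_ : fst @^-1` A = A `*` setT).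
    rewrite [LHS](product_measure1E P1 U)//=.
    by rewrite [X in _ * X]probability_setT mule1.
  by apply/seteqP; split => w // [].
have e1 : 'E_P[fun w => c (X1 w.1) (Y1 w.1)] = 'E_P1[fun w => c (X1 w) (Y1 w)].
  apply: expectation_pair_law => // B mB.
  exact: (lawfst _ (measurable_preimage (measurable_fun_pair
    (@measurable_funP _ _ _ _ _ X1) (@measurable_funP _ _ _ _ _ Y1)) mB)).
have e2 : 'E_P[fun w => c (Y1 w.1) (Z1 w)] = 'E_P2[fun w => c (Y2 w) (Z2 w)].
  exact: expectation_pair_law.
have lX : same_law (RVar P (mfun_pack (mfst X1))) X.
  move=> A mA; rewrite -(lX1 A mA).
  exact: (lawfst _ (measurable_preimage (@measurable_funP _ _ _ _ _ X1) mA)).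
have lZ : same_law (RVar P (Z1)) Z.
  move=> A mA; rewrite -(lZ2 A mA).
  exact: (lawZ _ (measurable_preimage measurable_snd mA)).
have : OT c X Z <= 'E_P[fun w => c (X1 w.1) (Z1 w)].
  exact: (OT_le_coupling c lX lZ).
move=> /le_trans; apply.
apply: (@le_trans _ _ ('E_P1[fun w => c (X1 w) (Y1 w)] +
                       'E_P2[fun w => c (Y2 w) (Z2 w)])).
  have mE (f h : (Om1 * N)%type -> borel E) : measurable_fun [set: Om1 * N] f ->
      measurable_fun [set: Om1 * N] h ->
      measurable_fun [set: Om1 * N] (fun w => (c (f w) (h w))%:E).
    by move=> mf mh; apply/measurable_EFinP; exact: measurable_cost.
  have mZ : measurable_fun [set: Om1 * N] Z1 by exact: measurable_funP.
  rewrite -e1 -e2 unlock -ge0_integralD//.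
  - apply: ge0_le_integral => //.
    + by move=> w _; rewrite lee_fin.
    + exact: mE.
    + by apply: emeasurable_funD; exact: mE.
    + by move=> w _; rewrite -EFinD lee_fin.
  - by move=> w _; rewrite lee_fin.
  - exact: mE.
  - by move=> w _; rewrite lee_fin.
  - exact: mE.
rewrite [X in X%:E]splitr EFinD addeACA.
by apply: leeD; exact: ltW.
Qed.

End cost.
End optimal_transport_theory.

(** * Finiteness of the transport cost *)

Section finiteness.
Context {R : realType} {E : ptopologicalType}.
Variables (c : E -> E -> R) (g : E -> R).
Hypothesis c_ge0 : forall x y, (0 <= c x y)%R.
Hypothesis c_meas :
  measurable_fun [set: borel E * borel E] (fun p => c p.1 p.2 : R).
Hypothesis g_meas : measurable_fun [set: borel E] (g : borel E -> R).
Implicit Types X Y : rvar R E.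
Local Open Scope ereal_scope.

Lemma expectation_le_ge0 d (O : measurableType d) (P : probability O R)
    (f h : O -> R) : measurable_fun [set: O] f -> measurable_fun [set: O] h ->
  (forall w, 0 <= f w <= h w)%R -> 'E_P[f] <= 'E_P[h].
Proof.
move=> mf mh fh; rewrite unlock; apply: ge0_le_integral => //.
- by move=> w _; rewrite lee_fin; have /andP[] := fh w.
- exact/measurable_EFinP.
- exact/measurable_EFinP.
- by move=> w _; rewrite lee_fin; have /andP[] := fh w.
Qed.

Lemma in_Lcg_expectations X : in_Lcg c g X -> exists x0 : E,
  [/\ 'E_(rv_prob X)[fun w => c (X w) x0] < +oo,
      'E_(rv_prob X)[fun w => c x0 (X w)] < +oo &
      'E_(rv_prob X)[fun w => `|g (X w)|%R] < +oo].
Proof.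
move=> [x0 hX]; exists x0.
have mX : measurable_fun setT (rv_fun X) by exact: measurable_funP.
have mx0 : measurable_fun [set: rv_space X] (fun=> x0 : borel E) by exact: measurable_cst.
have m1 := measurable_cost c_meas mX mx0.
have m2 := measurable_cost c_meas mx0 mX.
have m3 : measurable_fun setT (fun w => `|g (rv_fun X w)|%R).
  by apply: measurableT_comp => //; exact: measurableT_comp.
have m : measurable_fun setT (fun w : rv_space X =>
    (c (X w) x0 + c x0 (X w) + `|g (X w)|)%R).
  by apply: measurable_funD => //; exact: measurable_funD.
have c1 w := c_ge0 (X w) x0; have c2 w := c_ge0 x0 (X w).
by split; apply: le_lt_trans hX; apply: expectation_le_ge0 => // w;
  rewrite ?c1 ?c2 ?normr_ge0/= -subr_ge0; have := normr_ge0 (g (X w));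
  have := c1 w; have := c2 w; lra.
Qed.

Lemma in_Lcg_in_Lg X : in_Lcg c g X -> in_Lg g X.
Proof. by move=> /in_Lcg_expectations[x0 []]. Qed.

(** Allows two point masses carried by different probability spaces to be coupled on one of them. *)
Lemma same_law_cst d1 (O1 : measurableType d1) (P1 : probability O1 R)
    d2 (O2 : measurableType d2) (P2 : probability O2 R) (x : borel E) :
  same_law (RVar P1 (mfun_pack (measurable_cst x)))
           (RVar P2 (mfun_pack (measurable_cst x))).
Proof.
move=> A mA; rewrite /distribution /pushforward/= !preimage_cst.
by case: ifPn => _; rewrite ?probability_setT ?measure0.
Qed.

(** The path from X through the constants x0 and y0 to Y has three legs, of cost at most E[c(X,x0)],
    c(x0,y0) and E[c(y0,Y)]. *)
Lemma OT_lty X Y : polish R E -> quasi_pseudo_metric c ->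
  in_Lcg c g X -> in_Lcg c g Y -> OT c X Y < +oo.
Proof.
move=> hE [_ _ ctri] /in_Lcg_expectations[x0 [hX _ _]].
move=> /in_Lcg_expectations[y0 [_ hY _]].
pose Dx := RVar (rv_prob X) (mfun_pack (measurable_cst (x0 : borel E))).
pose Dy := RVar (rv_prob Y) (mfun_pack (measurable_cst (y0 : borel E))).
have h1 : OT c X Dx < +oo.
  apply: le_lt_trans hX.
  exact: (OT_le_coupling c (@same_law_refl _ _ X) (@same_law_refl _ _ Dx)).
have h3 : OT c Dy Y < +oo.
  apply: le_lt_trans hY.
  exact: (OT_le_coupling c (@same_law_refl _ _ Dy) (@same_law_refl _ _ Y)).
have h2 : OT c Dx Dy < +oo.
  have := OT_le_coupling c (@same_law_refl _ _ Dx)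
    (same_law_cst (rv_prob X) (rv_prob Y) y0).
  move=> /le_lt_trans; apply; rewrite [ltLHS](_ : _ = (c x0 y0)%:E) ?ltry//.
  exact: (expectation_cst (rv_prob X) (c x0 y0)).
have tri A B C := OT_triangle c_ge0 c_meas A B C hE ctri.
apply: le_lt_trans (tri X Dx Y) _; apply: lte_add_pinfty => //.
by apply: le_lt_trans (tri Dx Dy Y) _; exact: lte_add_pinfty.
Qed.

End finiteness.

(** * Perturbation of the ratio and conclusion *)

(** Here D, D' stand for gaps of means and a, a' for transport costs. The ratio grows with the cost
    and falls with the gap, so its worst case is (a + eps) / ((D - eps) + (a + eps)), whose
    denominator is again D + a. *)
Lemma gamma_ratio_perturbation (R : realFieldType) (a a' D D' eps gamma : R) :
  0 <= gamma <= 1 -> 0 < D -> 0 <= a -> a / (D + a) <= gamma ->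
  0 <= eps <= D -> 0 <= a' <= a + eps -> D - eps <= D' ->
  a' / (D' + a') <= gamma + (1 - gamma) * eps / D.
Proof.
move=> /andP[g0 g1] D0 a0 ag /andP[e0 eD] /andP[a'0 a'a] DD'.
have D'0 : 0 <= D' by lra.
have g'0 : 0 <= gamma + (1 - gamma) * eps / D.
  by rewrite addr_ge0// divr_ge0 ?mulr_ge0 ?subr_ge0// ltW.
(* This case covers 0/0 = 0; otherwise the denominator is positive. *)
have [->|a'n0] := eqVneq a' 0; first by rewrite mul0r.
have Da : 0 < D + a by lra.
have D'a' : 0 < D' + a' by rewrite ltr_wpDl// lt_def a'n0.
apply: (@le_trans _ _ ((a + eps) / (D + a))).
  rewrite ler_pdivrMr// mulrAC ler_pdivlMr//.
  (* After cross-multiplication the difference of the two sides is the sum of this product and the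
     next. *)
  have : 0 <= (a + eps - a') * (D - eps) by apply: mulr_ge0; lra.
  have : 0 <= (a + eps) * (D' - (D - eps)) by apply: mulr_ge0; lra.
  lra.
rewrite ler_pdivrMr//; rewrite ler_pdivrMr// in ag.
have : 0 <= (gamma * (D + a) - a) * (1 - eps / D).
  by apply: mulr_ge0; rewrite subr_ge0// ler_pdivrMr// mul1r.
have -> : (gamma + (1 - gamma) * eps / D) * (D + a) =
    a + eps + (gamma * (D + a) - a) * (1 - eps / D).
  by field; rewrite gt_eqF.
lra.
Qed.

Theorem theorem3p5 (R : realType) (E : ptopologicalType) (hE : polish R E)
  (c : E -> E -> R) (hc : quasi_pseudo_metric c)
  (c_lsc : lower_semicontinuous (fun z : E * E => (c z.1 z.2)%:E))
  (g : E -> R) (hg : measurable_fun [set: borel E] (g : borel E -> R))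
  (gamma : R) (hgamma : 0 <= gamma <= 1)
  (X Y : rvar R E) (hX : in_Lcg c g X) (hY : in_Lcg c g Y)
  (hXY : gamma_le c g gamma X Y) (hlt : mean g X < mean g Y)
  (d : E -> E -> R) (hd : is_metric d)
  (hdm : measurable_fun [set: borel (E * E)%type]
           ((fun z : E * E => d z.1 z.2) : borel (E * E)%type -> R))
  (hcd : forall x y : E, c x y <= d x y)
  (hgd : forall X' Y' : rvar R E, in_Lg g X' -> in_Lg g Y' ->
           (`|mean g X' - mean g Y'|%:E <= OT d X' Y')%E) :
  (forall (Y1 : rvar R E) (eps : R), in_Lcg c g Y1 ->
     (OT d Y Y1 <= eps%:E)%E -> eps <= mean g Y - mean g X ->
     mean g X <= mean g Y1 /\
     gamma_star c g X Y1
       <= gamma + (1 - gamma) * eps / (mean g Y - mean g X)) /\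
  (forall (X1 : rvar R E) (eps : R), in_Lcg c g X1 ->
     (OT d X X1 <= eps%:E)%E -> eps <= mean g Y - mean g X ->
     mean g X1 <= mean g Y /\
     gamma_star c g X1 Y
       <= gamma + (1 - gamma) * eps / (mean g Y - mean g X)).
Proof.
have [c0 cxx ctri] := hc; have [_ _ dsym dtri] := hd.
have d0 x y : 0 <= d x y by apply: le_trans (hcd x y).
have cmeas := lower_semicontinuous_measurable_prod hE c_lsc.
have dmeas := measurable_borel_prod hE hdm.
have tri A B C := OT_triangle c0 cmeas A B C hE ctri.
(* Every coupling competes in both infima, and c <= d pointwise. *)
have OTcd A B : (OT c A B <= OT d A B)%E.
  apply: le_ereal_inf_tmp => _ [d' [Om [P [A' [B' [lA lB ->]]]]]].
  apply: (le_trans (OT_le_coupling c lA lB)).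
  apply: expectation_le_ge0 => [||w]; last by rewrite c0 hcd.
    by apply: measurable_cost => //; exact: measurable_funP.
  by apply: measurable_cost => //; exact: measurable_funP.
have OTfin A B : in_Lcg c g A -> in_Lcg c g B ->
    OT c A B = (fine (OT c A B))%:E.
  move=> hA hB; rewrite fineK// ge0_fin_numE ?OT_ge0//.
  exact: (OT_lty c0 cmeas hg).
have fine0 A B : 0 <= fine (OT c A B) by rewrite fine_ge0// OT_ge0.
have Lg A := in_Lcg_in_Lg c0 cmeas hg (X := A).
have D0 : 0 < mean g Y - mean g X by rewrite subr_gt0.
have eps0 A B eps : (OT d A B <= eps%:E)%E -> 0 <= eps.
  by rewrite -lee_fin; apply: le_trans; exact: OT_ge0.
split => [Y1 eps hY1 hOT heps | X1 eps hX1 hOT heps].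
- have e0 := eps0 _ _ _ hOT.
  have : `|mean g Y - mean g Y1| <= eps.
    by rewrite -lee_fin (le_trans _ hOT)// hgd//; exact: Lg.
  (* The mean drops by at most eps, which does not exceed the gap, so the order of the means is
     preserved. *)
  rewrite ler_norml => /andP[_ hm]; split; first lra.
  apply: (gamma_ratio_perturbation hgamma D0 (fine0 X Y) hXY.2).
  + by rewrite e0.
  + rewrite fine0/= -lee_fin EFinD -!OTfin//.
    apply: le_trans (tri X Y Y1) _; apply: leeD => //.
    exact: le_trans (OTcd _ _) hOT.
  + lra.
- have e0 := eps0 _ _ _ hOT.
  have : `|mean g X - mean g X1| <= eps.
    by rewrite -lee_fin (le_trans _ hOT)// hgd//; exact: Lg.
  rewrite ler_norml => /andP[hm _]; split; first lra.
  apply: (gamma_ratio_perturbation hgamma D0 (fine0 X Y) hXY.2).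
  + by rewrite e0.
  + rewrite fine0/= addrC -lee_fin EFinD -!OTfin//.
    apply: le_trans (tri X1 X Y) _; apply: leeD => //.
    (* The path now starts with the leg from X1 to X; the possibly asymmetric c is first replaced by
       d, whose symmetry reverses the leg to match the hypothesis. *)
    by apply: le_trans (OTcd _ _) _; rewrite OT_sym.
  + lra.
Qed.
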